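(* Let $(K,\Delta)$ be a Hermitian form field with $\mu=0$ and $K\times 0\subseteq\Delta$, let $n\geq 3$ and $G=U_{2n+1}(K,\Delta)$. Let $\mathcal{D}$ denote the set of all conjugacy classes of $G$ of level $(0,K\times 0)$ and let $T$ denote the set of all nontrivial $(0,K\times 0)$-elementary extra short root transvections in $G$. Then $\mathrm{scn}_{\mathcal{D}}(T)=1$ if $K=\mathbb{F}_2$ and $(0,1)\in\Delta$, and $\mathrm{scn}_{\mathcal{D}}(T)=2$ otherwise.
   Context: Hermitian form fields. A Hermitian form field $(K,\Delta)$ consists of the following data. $K$ is a (commutative) field with a ring automorphism $x\mapsto\bar x$, an element $\lambda\in K$ with $\bar{\bar x}=\lambda x\bar\lambda$ for all $x\in K$ (hence $\bar\lambda=\lambda^{-1}$), and an element $\mu\in K$ with $\mu=\bar\mu\lambda$. The Heisenberg group $\mathfrak{H}$ is the set $K\times K$ with group operation $(x_1,y_1)\dot{+}(x_2,y_2)=(x_1+x_2,\,y_1+y_2-\bar x_1\mu x_2)$; the inverse of $(x,y)$ is $\dot{-}(x,y)=(-x,-y-\bar x\mu x)$, and $a\dot{-}b$ means $a\dot{+}(\dot{-}b)$. For $a\in K$ put $(x,y)\circ a=(xa,\bar a y a)$. A subgroup of $\mathfrak{H}$ stable under $\circ a$ for all $a\in K$ is called a $K^\bullet$-submodule. For $A\subseteq\mathfrak H$, $B\subseteq K$, $A\circ B$ denotes the subgroup of $\mathfrak H$ generated by all $a\circ b$, $a\in A,b\in B$. Put $\mathrm{tr}(x,y)=\bar x\mu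 x+y+\bar y\lambda$, $\Delta_{\min}=\{(0,x-\bar x\lambda)\mid x\in K\}$ and $\Delta_{\max}=\{(x,y)\in\mathfrak H\mid \mathrm{tr}(x,y)=0\}$. $\Delta$ is a $K^\bullet$-submodule of $\mathfrak H$ with $\Delta_{\min}\subseteq\Delta\subseteq\Delta_{\max}$. Odd form ideals. Put $J(\Delta)=\{y\in K\mid \exists z\in K: (y,z)\in\Delta\}$. For an ideal $I$ of $K$ with $\bar x\in I$ for all $x\in I$, put $\tilde I=\{x\in K\mid \overline{J(\Delta)}\mu x\subseteq I\}$, $\Omega^I_{\min}=\{(0,x-\bar x\lambda)\mid x\in I\}\dot{+}\Delta\circ I$ and $\Omega^I_{\max}=\Delta\cap(\tilde I\times I)$. An odd form ideal of $(K,\Delta)$ is a pair $(I,\Omega)$ where $I$ is an ideal of $K$ with $\bar x\in I$ for all $x\in I$ and $\Omega$ is a $K^\bullet$-submodule of $\mathfrak H$ with $\Omega^I_{\min}\subseteq\Omega\subseteq\Omega^I_{\max}$. If $\mu=0$ and $K\times0\subseteq\Delta$, then $(0,K\times 0)$ is an odd form ideal. The unitary group. Let $M=K^{2n+1}$ (column vectors) with standard basis indexed $(e_1,\dots,e_n,e_0,e_{-n},\dots,e_{-1})$; rows and columns of $(2n+1)\times(2n+1)$ matrices are indexed in the same way. Define $B(u,v)=\sum_{i=1}^n\bar u_iv_{-i}+\bar u_0\mu v_0+\sum_{i=-n}^{-1}\bar u_i\lambda v_{-i}$ and $Q(u)=(u_0,\sum_{i=1}^n\bar u_iu_{-i})\in\mathfrak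 H$. Then $U_{2n+1}(K,\Delta)$ is the group of all $\sigma\in GL_{2n+1}(K)$ with $B(\sigma u,\sigma v)=B(u,v)$ and $Q(\sigma u)\dot{-}Q(u)\in\Delta$ for all $u,v\in M$. Transvections. Let $\Theta_{\mathrm{hb}}=\{\pm1,\dots,\pm n\}$, $\epsilon(i)=1$ if $i>0$ and $\epsilon(i)=-1$ if $i<0$. Let $e$ be the identity matrix and $e^{ij}$ the matrix units. Short root transvections are the matrices $T_{ij}(x)=e+xe^{ij}-\lambda^{(\epsilon(j)-1)/2}\bar x\lambda^{(1-\epsilon(i))/2}e^{-j,-i}$ with $i,j\in\Theta_{\mathrm{hb}}$, $i\neq\pm j$, $x\in K$. For a subset $\Omega\subseteq K\times K$ put $\Omega^{1}=\Omega$ and $\Omega^{-1}=\{(x,y)\mid (x,\bar y)\in\Omega\}$. Extra short root transvections are the matrices $T_i(x,y)=e+xe^{0,-i}-\lambda^{-(1+\epsilon(i))/2}\bar x\mu e^{i0}+ye^{i,-i}$ with $i\in\Theta_{\mathrm{hb}}$, $(x,y)\in\Delta^{-\epsilon(i)}$. All these lie in $U_{2n+1}(K,\Delta)$; nontrivial means different from $e$. $E=EU_{2n+1}(K,\Delta)$ is the subgroup generated by all short and extra short root transvections. Relative subgroups. Let $(I,\Omega)$ be an odd form ideal. $T_{ij}(x)$ is $(I,\Omega)$-elementary if $x\in I$; $T_i(x,y)$ is $(I,\Omega)$-elementary if $(x,y)\in\Omega^{-\epsilon(i)}$ (so the $(0,K\times0)$-elementary extra short root transvections are the $T_i(x,0)$,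 $i\in\Theta_{\mathrm{hb}}$, $x\in K$). $EU_{2n+1}((K,\Delta),(I,\Omega))$ is the normal closure in $E$ of the subgroup generated by all $(I,\Omega)$-elementary transvections. $U_{2n+1}((K,\Delta),(I,\Omega))$ is the subgroup of all $\sigma\in U_{2n+1}(K,\Delta)$ with $\sigma_{ij}-\delta_{ij}\in I$ for all $i,j\in\Theta_{\mathrm{hb}}$ and $Q(\sigma u)\dot{-}Q(u)\in\Omega$ for all $u\in M$ with $u_0\in J(\Delta)$. $NU_{2n+1}((K,\Delta),(I,\Omega))$ is its normaliser in $U_{2n+1}(K,\Delta)$, and $CU_{2n+1}((K,\Delta),(I,\Omega))=\{\sigma\in NU_{2n+1}((K,\Delta),(I,\Omega))\mid [\sigma,E]\leq U_{2n+1}((K,\Delta),(I,\Omega))\}$. Level. Let $n\geq3$. It is known (Bak–Preusser) that for every subgroup $H$ of $U_{2n+1}(K,\Delta)$ normalised by $E$ there is a unique odd form ideal $(I,\Omega)$ with $EU_{2n+1}((K,\Delta),(I,\Omega))\subseteq H\subseteq CU_{2n+1}((K,\Delta),(I,\Omega))$; it is called the level of $H$. The level of a conjugacy class $C$ of $G=U_{2n+1}(K,\Delta)$ is the level of the subgroup generated by $C$. Covering numbers. For a group $G$ and subsets $S,X\subseteq G$, $\mathrm{cn}_X(S)$ is the least positive integer $m$ with $S\subseteq X^m=\{x_1\cdots x_m\mid x_i\in X\}$ ($\infty$ if there is none), and $\mathrm{scn}_X(S)=\mathrm{cn}_{X\cup X^{-1}}(S)$. For a set $\mathcal X$ of subsets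 of $G$, $\mathrm{scn}_{\mathcal X}(S)=\sup\{\mathrm{scn}_X(S)\mid X\in\mathcal X\}$. *)

(* Defs.v *)
From mathcomp Require Import all_boot all_order all_algebra.
From mathcomp Require Import boolp classical_sets constructive_ereal.

Set Implicit Arguments.
Unset Strict Implicit.
Unset Printing Implicit Defensive.

Import Order.TTheory GRing.Theory Num.Theory.
Local Open Scope classical_set_scope.
Local Open Scope ring_scope.

(** * Subgroups of the unit group of a ring, and covering numbers *)

Section Groups.
Variable R : unitRingType.
Implicit Types (A C G H N S X : set R) (x : R).

(* A subgroup of the group of units of R; the infinite matrix groups below are
   all represented as sets of (invertible) matrices. *)
Definition is_subgroup H : Prop :=
  [/\ H `<=` [set x | x \is a GRing.unit], H 1,
      forall x y, H x -> H y -> H (x * y)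
    & forall x, H x -> H x^-1].

Definition gen A : set R := smallest is_subgroup A.

Definition conj_set x A : set R := [set x * h * x^-1 | h in A].

Definition conj_by A x : set R := [set g * x * g^-1 | g in A].

Definition is_conj_class G C : Prop := exists2 x, G x & C = conj_by G x.

Definition normaliser G H : set R := [set g | G g /\ conj_set g H = H].

Definition normal_subgroup G N : Prop :=
  [/\ is_subgroup N, N `<=` G & forall g, G g -> conj_set g N `<=` N].

Definition normal_closure G H : set R := smallest (normal_subgroup G) H.

(* The subgroup [x, A]. *)
Definition commutators x A : set R :=
  gen [set x * y * x^-1 * y^-1 | y in A].

Definition pow_set X (m : nat) : set R :=
  [set \prod_(i < m) f i | f in [set f : 'I_m -> R | forall i, X (f i)]].

Definition inv_set X : set R := [set x^-1 | x in X].

(* Covering numbers take their values in the positive integers extended by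
   infinity, viewed inside \bar int. *)
Definition cn X S : \bar int :=
  match pselect (exists m : nat, `[< (0 < m)%N /\ S `<=` pow_set X m >]) with
  | left ex_m => ((ex_minn ex_m)%:Z)%:E
  | right _ => +oo%E
  end.

Definition scn X S : \bar int := cn (X `|` inv_set X) S.

(* [supremum] is the least upper bound for the order of \bar int, with the
   convention that the supremum of the empty family is 0. *)
Definition scn_family (XX : set (set R)) S : \bar int :=
  supremum 0%E [set scn X S | X in XX].

End Groups.

(** * Hermitian form fields and odd form ideals *)

Record hermitian_form (K : fieldType) := HermitianForm {
  bar : {rmorphism K -> K};
  lam : K;
  mu : K;
  bar_bij : bijective bar;
  bar_bar : forall x, bar (bar x) = lam * x * bar lam;
  mu_bar : mu = bar mu * lam
}.

Section Heisenberg.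
Variables (K : fieldType) (F : hermitian_form K).
Local Notation bar := (bar F).
Local Notation lam := (lam F).
Local Notation mu := (mu F).
Implicit Types (a b : K * K) (A B Om : set (K * K)).

Definition hadd a b : K * K := (a.1 + b.1, a.2 + b.2 - bar a.1 * mu * b.1).

Definition hopp a : K * K := (- a.1, - a.2 - bar a.1 * mu * a.1).

Definition hsub a b : K * K := hadd a (hopp b).

Definition hact a (c : K) : K * K := (a.1 * c, bar c * a.2 * c).

Definition is_hsubgroup A : Prop :=
  [/\ A (0, 0), forall a b, A a -> A b -> A (hadd a b)
    & forall a, A a -> A (hopp a)].

Definition is_Kbullet_submodule A : Prop :=
  is_hsubgroup A /\ forall a c, A a -> A (hact a c).

Definition hact_set A (B : set K) : set (K * K) :=
  smallest is_hsubgroup [set hact a c | a in A & c in B].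

Definition hadd_set A B : set (K * K) := [set hadd a b | a in A & b in B].

Definition htr a : K := bar a.1 * mu * a.1 + a.2 + bar a.2 * lam.

Definition Delta_min : set (K * K) := [set (0, x - bar x * lam) | x in setT].

Definition Delta_max : set (K * K) := [set a | htr a = 0].

(* Om^1 = Om and Om^{-1}; only used for s = 1 and s = -1. *)
Definition sgn_set Om (s : int) : set (K * K) :=
  if s == 1 then Om else [set a | Om (a.1, bar a.2)].

End Heisenberg.

Record hermitian_form_field (K : fieldType) := HermitianFormField {
  hform :> hermitian_form K;
  Delta : set (K * K);
  Delta_submodule : is_Kbullet_submodule hform Delta;
  Delta_min_sub : Delta_min hform `<=` Delta;
  Delta_sub_max : Delta `<=` Delta_max hform
}.

Section OddFormIdeals.
Variables (K : fieldType) (F : hermitian_form_field K).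
Local Notation bar := (bar F).
Local Notation lam := (lam F).
Local Notation mu := (mu F).
Local Notation Delta := (Delta F).
Implicit Types (I : set K) (Om : set (K * K)).

Definition JDelta : set K := [set y | exists z, Delta (y, z)].

Definition is_ideal I : Prop :=
  [/\ I 0, forall x y, I x -> I y -> I (x + y)
    & forall c x, I x -> I (c * x)].

Definition tilde I : set K :=
  [set x | forall y, JDelta y -> I (bar y * mu * x)].

Definition Omega_min I : set (K * K) :=
  hadd_set F [set (0, x - bar x * lam) | x in I] (hact_set F Delta I).

Definition Omega_max I : set (K * K) := Delta `&` (tilde I `*` I).

Definition is_odd_form_ideal I Om : Prop :=
  [/\ is_ideal I, forall x, I x -> I (bar x), is_Kbullet_submodule F Om,
      Omega_min I `<=` Om & Om `<=` Omega_max I].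

End OddFormIdeals.

(** * Odd-dimensional unitary groups *)

(* The index set (1, ..., n, 0, -n, ..., -1) is 'I_(2n+1), in this order: the
   index i > 0 is the ordinal i - 1, the index 0 is the ordinal n and -i is the
   ordinal 2n - (i - 1).  Hence i |-> -i is [rev_ord], and the positive
   (negative) indices are the ordinals smaller (larger) than n. *)

Section Unitary.
Variables (K : fieldType) (F : hermitian_form_field K) (n : nat).
Local Notation bar := (bar F).
Local Notation lam := (lam F).
Local Notation mu := (mu F).
Local Notation Delta := (Delta F).
Local Notation index := 'I_(n.*2.+1).
Local Notation M := 'cV[K]_(n.*2.+1).
Local Notation Mat := 'M[K]_(n.*2.+1).
Implicit Types (i j : index) (u v : M) (s : Mat).
Implicit Types (I : set K) (Om : set (K * K)).

Definition idx0 : index := inord n.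

Definition hb i : bool := i != idx0.

Definition eps i : int := if (i < n)%N then 1 else -1.

Definition formB u v : K :=
  \sum_(i : index | (i < n)%N) bar (u i 0) * v (rev_ord i) 0
  + bar (u idx0 0) * mu * v idx0 0
  + \sum_(i : index | (n < i)%N) bar (u i 0) * lam * v (rev_ord i) 0.

Definition formQ u : K * K :=
  (u idx0 0, \sum_(i : index | (i < n)%N) bar (u i 0) * u (rev_ord i) 0).

Definition U : set Mat :=
  [set s | [/\ s \in unitmx,
               forall u v, formB (s *m u) (s *m v) = formB u v
             & forall u, Delta (hsub F (formQ (s *m u)) (formQ u))]].

Definition Tshort i j (x : K) : Mat :=
  1 + x *: delta_mx i j
  - (lam ^ ((eps j - 1) %/ 2)%Z * bar x * lam ^ ((1 - eps i) %/ 2)%Z)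
      *: delta_mx (rev_ord j) (rev_ord i).

Definition Textra i (x y : K) : Mat :=
  1 + x *: delta_mx idx0 (rev_ord i)
  - (lam ^ (- ((1 + eps i) %/ 2)%Z) * bar x * mu) *: delta_mx i idx0
  + y *: delta_mx i (rev_ord i).

(* With I = K, resp. Om = Delta, these are the sets of all short, resp. extra
   short root transvections. *)
Definition short_transvections I : set Mat :=
  [set t | exists i j x,
     [/\ hb i, hb j, i != j & i != rev_ord j] /\ I x /\ t = Tshort i j x].

Definition extra_short_transvections Om : set Mat :=
  [set t | exists i x y,
     [/\ hb i, sgn_set F Om (- eps i) (x, y) & t = Textra i x y]].

Definition E : set Mat :=
  gen (short_transvections setT `|` extra_short_transvections Delta).

Definition EU I Om : set Mat :=
  normal_closure E
    (gen (short_transvections I `|` extra_short_transvections Om)).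

Definition Urel I Om : set Mat :=
  [set s | [/\ U s,
               forall i j, hb i -> hb j -> I (s i j - (i == j)%:R)
             & forall u, JDelta F (u idx0 0) ->
                 Om (hsub F (formQ (s *m u)) (formQ u))]].

Definition NU I Om : set Mat := normaliser U (Urel I Om).

Definition CU I Om : set Mat :=
  [set s | NU I Om s /\ commutators s E `<=` Urel I Om].

(* (I, Om) is the level of H: for n >= 3 and H normalised by E, there is
   exactly one such (I, Om) (Bak-Preusser), which makes this relation
   functional. *)
Definition is_level (H : set Mat) I Om : Prop :=
  [/\ is_odd_form_ideal F I Om, EU I Om `<=` H & H `<=` CU I Om].

Definition classes_of_level I Om : set (set Mat) :=
  [set C | is_conj_class U C /\ is_level (gen C) I Om].

Definition nontrivial_extra_short Om : set Mat :=
  [set t | extra_short_transvections Om t /\ t <> 1].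

End Unitary.

Arguments U {K} F n.
Arguments E {K} F n.
Arguments EU {K} F n I Om.
Arguments Urel {K} F n I Om.
Arguments NU {K} F n I Om.
Arguments CU {K} F n I Om.
Arguments classes_of_level {K} F n I Om.
Arguments short_transvections {K} F n I.
Arguments extra_short_transvections {K} F n Om.
Arguments nontrivial_extra_short {K} F n Om.

(* Main.v *)
From HB Require Import structures.
Require Import Defs.
From mathcomp Require Import all_boot all_order all_algebra.
From mathcomp Require Import boolp classical_sets constructive_ereal.
From mathcomp Require Import zify ring.

(** Since mu vanishes, e_0 spans the radical of the form, so every isometry g
    maps e_0 to a multiple of itself, and g consists of an isometry of the
    hyperbolic space on the indices +-1, ..., +-n, an arbitrary row of index 0
    and a nonzero corner entry. The elements that matter are
    [scal_row a w] = a + e_0 w with a row w: the homothety by a modulo the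
    radical. Conjugation by g acts on them through the row alone,
    w |-> t w g^-1 with g e_0 = t e_0 ([conj_scal_row]).

    The relative subgroup of (0, K x 0) consists of the invertible
    [scal_row 1 w]. Commuting with E modulo this subgroup forces the hyperbolic
    block to be scalar, so a class of level (0, K x 0) is the class of some
    [scal_row a w]; moreover w <> 0, as otherwise the class is central
    ([class_of_levelP]). Conversely the class of [scal_row 1 w] has this level
    if w <> 0 and the matrix is invertible ([class_of_level_scal_row]).

    Upper bound 2: the orbit of any nonzero row contains two rows with
    difference x e_j for any given x and any j <> 0 ([row_orbit_diff]), because
    one short root transvection T_kj suffices to alter nothing but the entry j
    of a suitable row in the orbit. Hence each T_i(x,0) is a quotient of two
    elements of the class.

    Exact value: if K contains some c different from 0 and 1, the class of
    diag(1, ..., c, ..., 1) contains no T_i(x,0), since the corner entry is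
    invariant under conjugation, nor does its inverse, as the inverse of
    T_i(x,0) is T_i(-x,0). Otherwise K = F_2 and the hyperbolic block
    ranges over an orthogonal or a symplectic group according to whether (0,1)
    lies in Delta. In the orthogonal case the rows are divided into singular
    and nonsingular ones, the T_i(x,0) have singular rows, and the class of a
    nonsingular row misses them ([class_nonsingular]). In the symplectic case
    all nonzero rows are conjugate ([sympl_transitive]), so every class of the
    given level contains all nontrivial T_i(x,0). *)

Set Implicit Arguments.
Unset Strict Implicit.
Unset Printing Implicit Defensive.

Import Order.TTheory GRing.Theory Num.Theory.
Local Open Scope classical_set_scope.
Local Open Scope ring_scope.

(** * Subgroups and covering numbers *)

Section Covering.
Variable R : unitRingType.
Implicit Types (A C H X S : set R) (x : R).

Lemma gen_subgroup A : A `<=` [set x | x \is a GRing.unit] ->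
  is_subgroup (gen A).
Proof.
move=> Aunit; split=> [|H [[]]|x y Ax Ay H HA|x Ax H HA] //.
- apply: smallest_sub => //; split=> //; first exact: unitr1.
    by move=> x y /= ux uy; rewrite unitrMr.
  by move=> x; rewrite /= unitrV.
- by case: (HA) => -[_ _ mulH _] _; apply: mulH; [apply: Ax|apply: Ay].
- by case: (HA) => -[_ _ _ invH] _; apply: invH; apply: Ax.
Qed.

Lemma pow_set1 X : pow_set X 1 = X.
Proof.
apply/seteqP; split=> [_ [f Xf <-]|x Xx]; first by rewrite big_ord1.
by exists (fun=> x) => //; rewrite big_ord1.
Qed.

Lemma pow_set2 X x y : X x -> X y -> pow_set X 2 (x * y).
Proof.
move=> Xx Xy; exists (fun i : 'I_2 => if i == ord0 then x else y).
  by move=> i /=; case: ifP.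
by rewrite big_ord_recl big_ord1.
Qed.

Lemma cn_le X S m : (0 < m)%N -> S `<=` pow_set X m -> (cn X S <= m%:Z%:E)%E.
Proof.
move=> m0 SX; rewrite /cn; case: pselect => [exm|]; last first.
  by case; exists m; apply/asboolP.
case: ex_minnP => k _ /(_ m) leq_km; rewrite lee_fin lez_nat.
by apply: leq_km; apply/asboolP.
Qed.

Lemma cn_gt1 X S : ~ S `<=` X -> (2%:Z%:E <= cn X S)%E.
Proof.
move=> SX; rewrite /cn; case: pselect => [exm|]; last by rewrite leey.
case: ex_minnP => -[|[|k]] /asboolP[//= _ SXk] _.
by case: SX; rewrite -[X]pow_set1.
Qed.

Lemma cn_gt0 X S : (1%:Z%:E <= cn X S)%E.
Proof.
rewrite /cn; case: pselect => [exm|]; last by rewrite leey.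
by case: ex_minnP => -[|k] /asboolP[//= _ SXk] _.
Qed.

End Covering.

Lemma supremum_max d (T : orderType d) (x0 x : T) (A : set T) :
  A x -> ubound A x -> supremum x0 A = x.
Proof.
move=> Ax ubx; have supx : supremums A x by split=> // y /(_ x Ax).
rewrite /supremum; case: eqP => [A0|_]; first by move: Ax; rewrite A0.
by case: xgetP => [y _ supy|/(_ x)//]; apply: (is_subset1_supremums supy supx).
Qed.

(** * The form and its isometries *)

Section Unitary.
Variables (K : fieldType) (F : hermitian_form_field K) (n : nat).
Hypothesis mu0 : mu F = 0.
Hypothesis Delta_horizontal : [set: K] `*` [set 0] `<=` Delta F.
Local Notation bar := (bar F).
Local Notation lam := (lam F).
Local Notation Delta := (Delta F).
Local Notation index := 'I_(n.*2.+1).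
Local Notation M := 'cV[K]_(n.*2.+1).
Local Notation Row := 'rV[K]_(n.*2.+1).
Local Notation Mat := 'M[K]_(n.*2.+1).
Local Notation i0 := (idx0 n).
Local Notation er := (@delta_mx K 1 n.*2.+1 0).
Local Notation ec i := (@delta_mx K n.*2.+1 1 i 0).
Local Notation U := (U F n).
Local Notation E := (E F n).
Local Notation form := (Defs.formB F).
Implicit Types (i j k : index) (u v : M) (w z : Row) (g h s : Mat).
Implicit Types (a c x y : K).

Lemma idx0E : i0 = n :> nat.
Proof. by rewrite inordK // -addnn ltnS leq_addr. Qed.

Lemma rev_idx0 : rev_ord i0 = i0.
Proof. by apply: val_inj; rewrite /= idx0E -addnn subSS addnK. Qed.

Lemma rev_eq i j : (rev_ord i == j) = (i == rev_ord j).
Proof. by apply/eqP/eqP => [<-|->]; rewrite rev_ordK. Qed.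

Lemma hb_rev i : hb (rev_ord i) = hb i.
Proof. by rewrite /hb rev_eq rev_idx0. Qed.

Lemma hbE i : hb i = (i < n)%N || (n < i)%N.
Proof. by rewrite /hb -val_eqE /= idx0E neq_ltn. Qed.

Lemma rev_ltn i : (rev_ord i < n)%N = (n < i)%N.
Proof. by rewrite /=; have := ltn_ord i; lia. Qed.

Lemma rev_gtn i : (n < rev_ord i)%N = (i < n)%N.
Proof. by rewrite -rev_ltn rev_ordK. Qed.

Lemma hb_rev_neq i : hb i -> rev_ord i != i.
Proof.
rewrite hbE => hi; apply/eqP => e; move: (rev_ltn i); rewrite e.
by case/orP: hi; lia.
Qed.

Lemma lam_bar : lam * bar lam = 1.
Proof. by have := bar_bar F 1; rewrite !rmorph1 mulr1. Qed.

Lemma lam_neq0 : lam != 0.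
Proof.
by apply/eqP => l0; have /eqP := lam_bar; rewrite l0 mul0r eq_sym oner_eq0.
Qed.

Lemma barK : involutive bar.
Proof. by move=> x; rewrite bar_bar mulrAC lam_bar mul1r. Qed.

Lemma bar_lam : bar lam = lam^-1.
Proof. by apply: (mulfI lam_neq0); rewrite lam_bar divff // lam_neq0. Qed.

Lemma bar_eq0 x : (bar x == 0) = (x == 0).
Proof. by rewrite fmorph_eq0. Qed.

(** The lam-hermitian symmetrisation of this form is the sesquilinear form, and
    its diagonal is the quadratic form, so that both conditions on an isometry
    can be read off from its effect on this form. *)
Definition halfB u v : K :=
  \sum_(i : index | (i < n)%N) bar (u i 0) * v (rev_ord i) 0.

Lemma formBE u v : form u v = halfB u v + lam * bar (halfB v u).
Proof.
rewrite /Defs.formB mu0 mulr0 mul0r addr0; congr (_ + _).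
rewrite /halfB rmorph_sum mulr_sumr (reindex_inj rev_ord_inj) /=.
apply: eq_big => [i|i _]; first exact: rev_gtn.
by rewrite rmorphM barK rev_ordK; ring.
Qed.

Lemma halfBDl u u' v : halfB (u + u') v = halfB u v + halfB u' v.
Proof.
by rewrite -big_split; apply: eq_bigr => i _; rewrite mxE rmorphD mulrDl.
Qed.

Lemma halfBDr u v v' : halfB u (v + v') = halfB u v + halfB u v'.
Proof. by rewrite -big_split; apply: eq_bigr => i _; rewrite mxE mulrDr. Qed.

Lemma halfBZl a u v : halfB (a *: u) v = bar a * halfB u v.
Proof.
by rewrite mulr_sumr; apply: eq_bigr => i _; rewrite mxE rmorphM mulrA.
Qed.

Lemma halfBZr a u v : halfB u (a *: v) = a * halfB u v.
Proof. by rewrite mulr_sumr; apply: eq_bigr => i _; rewrite mxE mulrCA. Qed.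

Lemma halfB_deltal i v :
  halfB (ec i) v = if (i < n)%N then v (rev_ord i) 0 else 0.
Proof.
case: ifP => [ltin|gein].
  rewrite /halfB (bigD1 i) //= mxE !eqxx rmorph1 mul1r big1 ?addr0 // => j.
  by case/andP=> _ /negPf ji; rewrite mxE ji rmorph0 mul0r.
apply: big1 => j ltjn; rewrite mxE (_ : j == i = false) ?rmorph0 ?mul0r //.
by apply: contraFF gein => /eqP <-.
Qed.

Lemma halfB_deltar u i :
  halfB u (ec i) = if (n < i)%N then bar (u (rev_ord i) 0) else 0.
Proof.
case: ifP => [gtin|lein].
  rewrite /halfB (bigD1 (rev_ord i)) ?rev_ltn //= mxE rev_ordK !eqxx mulr1.
  rewrite big1 ?addr0 // => j /andP[_ /negPf ji].
  by rewrite mxE rev_eq ji mulr0.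
apply: big1 => j ltjn; rewrite mxE rev_eq (_ : j == _ = false) ?mulr0 //.
by apply: contraFF lein => /eqP ej; rewrite -rev_ltn -ej.
Qed.

Lemma Delta_hadd x y : Delta (0, y) -> Delta (x, y).
Proof.
case: (Delta_submodule F) => -[_ Dadd _] _ Dy.
have Dx : Delta (x, 0) by apply: Delta_horizontal.
by have := Dadd _ _ Dx Dy; rewrite /hadd /= addr0 add0r mulr0 subr0.
Qed.

Lemma hsubE (b c : K * K) : hsub F b c = (b.1 - c.1, b.2 - c.2).
Proof. by rewrite /hsub /hadd /hopp /= mu0 !mulr0 !mul0r !subr0. Qed.

(** The correction term yy u v - lam bar (yy v u) cancels in the symmetrised
    form, and on the diagonal it is an element of the minimal form
    parameter. *)
Lemma U_halfB s (yy : M -> M -> K) : s \in unitmx ->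
  (forall u v, halfB (s *m u) (s *m v) =
     halfB u v + yy u v - lam * bar (yy v u)) -> U s.
Proof.
move=> us sP; split=> // [u v|u].
  rewrite !formBE !sP !(rmorphD, rmorphN, rmorphM, rmorphB) /= barK.
  have := lam_bar; move: (bar lam) lam => l' l ll'.
  by rewrite !mulrDr !mulrN !mulrA ll' mul1r; ring.
rewrite hsubE; apply: Delta_hadd.
apply: Delta_min_sub; exists (yy u u) => //.
by rewrite /formQ /= -/(halfB _ _) -/(halfB _ _) sP; congr (_, _); ring.
Qed.

Lemma formB_e0r u : form u (ec i0) = 0.
Proof.
by rewrite formBE halfB_deltar halfB_deltal idx0E ltnn rmorph0 mulr0 addr0.
Qed.

(** Pairing v with e_(-i) isolates its entry of index i, up to a unit. *)
Lemma formB_radical v : (forall u, form u v = 0) -> v = v i0 0 *: ec i0.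
Proof.
move=> Bv; apply/matrixP => i j; rewrite ord1 !mxE andbT.
case: eqP => [->|/eqP hi]; first by rewrite mulr1.
have := Bv (ec (rev_ord i)).
rewrite formBE halfB_deltal halfB_deltar rev_ltn rev_gtn rev_ordK mulr0.
have := hi; rewrite -/(hb i) hbE => /orP[] lti; rewrite lti ltnNge ltnW //=.
  by rewrite barK add0r => /eqP; rewrite mulf_eq0 (negPf lam_neq0) => /eqP.
by rewrite rmorph0 mulr0 addr0.
Qed.

Lemma U_unit s : U s -> s \is a GRing.unit.
Proof. by case. Qed.

Lemma U_mul g h : U g -> U h -> U (g * h).
Proof.
case=> ug Bg Qg [uh Bh Qh]; split=> [|u v|u].
- by rewrite unitmx_mul ug.
- by rewrite -!mulmxA Bg.
case: (Delta_submodule F) => -[_ Dadd _] _.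
have := Dadd _ _ (Qg (h *m u)) (Qh u).
by rewrite !hsubE -!mulmxA /hadd /= mu0 mulr0 mul0r subr0 !subrKA.
Qed.

Lemma U_inv g : U g -> U g^-1.
Proof.
case=> ug Bg Qg; have gK u : g *m (g^-1 *m u) = u.
  by rewrite mulmxA mulmxV // mul1mx.
split=> [|u v|u]; first by rewrite unitmx_inv.
  by rewrite -Bg !gK.
case: (Delta_submodule F) => -[_ _ Dopp] _.
have := Dopp _ (Qg (g^-1 *m u)).
by rewrite gK !hsubE /hopp /= mu0 mulr0 mul0r subr0 !opprB.
Qed.

Lemma formB_U_adj g u v : U g -> form u (g *m v) = form (g^-1 *m u) v.
Proof.
by move=> Ug; case: (U_inv Ug) => ? <- _; rewrite mulKmx //; case: Ug.
Qed.

(** Isometries preserve the radical of the form, which e_0 spans. *)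
Lemma U_e0 g : U g -> exists t, g *m ec i0 = t *: ec i0.
Proof.
move=> Ug; exists ((g *m ec i0) i0 0); apply: formB_radical => u.
by rewrite formB_U_adj // formB_e0r.
Qed.

(** * Transvections as isometries *)

Lemma mul_row_col w k : w *m ec k = (w 0 k)%:M.
Proof. by rewrite -colE; apply/matrixP => i j; rewrite !ord1 !mxE eqxx. Qed.

Lemma mul_row_delta w i j : w *m delta_mx i j = w 0 i *: er j.
Proof.
by rewrite -(mul_delta_mx (0 : 'I_1)) mulmxA mul_row_col mul_scalar_mx.
Qed.

Lemma mul_delta_col i j u : delta_mx i j *m u = u j 0 *: ec i.
Proof.
rewrite -(mul_delta_mx (0 : 'I_1)) -mulmxA -rowE.
rewrite (_ : row j u = (u j 0)%:M) ?mul_mx_scalar //.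
by apply/matrixP => a b; rewrite !ord1 !mxE eqxx.
Qed.

(** The coefficient of e^{-j,-i} in T_ij(x), up to sign: invariance of the form
    determines it by x. *)
Definition opp_coef i j x : K :=
  lam ^ ((eps j - 1) %/ 2)%Z * bar x * lam ^ ((1 - eps i) %/ 2)%Z.

Lemma opp_coefE i j x : opp_coef i j x =
  (if (j < n)%N then 1 else lam^-1) * bar x * (if (i < n)%N then 1 else lam).
Proof. by rewrite /opp_coef /eps; case: ifP; case: ifP. Qed.

Lemma opp_coefN i j x : opp_coef i j (- x) = - opp_coef i j x.
Proof. by rewrite /opp_coef rmorphN mulrN mulNr. Qed.

Lemma row_Tshort w i j x : w *m Tshort F i j x =
  w + (x * w 0 i) *: er j
    - (opp_coef i j x * w 0 (rev_ord j)) *: er (rev_ord i).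
Proof.
by rewrite mulmxBr mulmxDr mulmx1 -!scalemxAr !mul_row_delta !scalerA.
Qed.

Lemma Tshort_col i j x u : Tshort F i j x *m u =
  u + (x * u j 0) *: ec i
    - (opp_coef i j x * u (rev_ord i) 0) *: ec (rev_ord j).
Proof.
by rewrite mulmxBl mulmxDl mul1mx -!scalemxAl !mul_delta_col !scalerA.
Qed.

Lemma Tshort_unit i j x : hb i -> hb j -> i != j -> i != rev_ord j ->
  Tshort F i j x \is a GRing.unit.
Proof.
move=> hi hj /negPf ij /negPf irj.
suff: Tshort F i j (- x) *m Tshort F i j x = 1%:M by case/mulmx1_unit.
apply/row_matrixP => k; rewrite row_mul !rowE mulmx1 !row_Tshort !mxE eqxx /=.
rewrite [i == rev_ord i]eq_sym (negPf (hb_rev_neq hi)) (negPf (hb_rev_neq hj)).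
rewrite (inj_eq rev_ord_inj) [j == i]eq_sym ij opp_coefN.
by apply/matrixP => a b; rewrite !mxE /= !mulr0n; ring.
Qed.

Lemma U_Tshort i j x : hb i -> hb j -> i != j -> i != rev_ord j ->
  U (Tshort F i j x).
Proof.
move=> hi hj ij irj.
(* T_ij(x) changes the coordinates i and -j. If i and j have the same sign,
   the two contributions cancel; otherwise they differ by the involution. *)
pose yy u v : K := if (i < n)%N then
    if (j < n)%N then 0 else bar x * bar (u j 0) * v (rev_ord i) 0
  else if (j < n)%N then x * bar (u (rev_ord i) 0) * v j 0 else 0.
apply: (@U_halfB _ yy) => [|u v]; first exact: Tshort_unit.
have nij := negPf ij; have nirj := negPf irj.
rewrite !Tshort_col -!scaleNr !halfBDl !halfBDr !halfBZl !halfBZr.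
rewrite !halfB_deltal !halfB_deltar !mxE !rev_ordK !rev_ltn !rev_gtn eqxx.
rewrite !andbT.
rewrite (inj_eq rev_ord_inj) [rev_ord i == i](negPf (hb_rev_neq hi)).
rewrite [j == rev_ord j]eq_sym (negPf (hb_rev_neq hj)).
rewrite [j == i]eq_sym nij !mulr0n.
rewrite !opp_coefE /yy; move: hi hj; rewrite !hbE.
case: (ltngtP i n) => // _ _; case: (ltngtP j n) => // _ _;
  rewrite !(rmorphN, rmorphM, fmorphV, rmorph1, rmorph0, bar_lam, barK) ?invrK;
 by field; rewrite ?lam_neq0.
Qed.

(** * Isometries acting by a scalar modulo the radical *)

(** The matrices that induce the homothety by a on the quotient by the radical
    and preserve the latter; w is the deviation of the row of index 0. *)
Definition scal_row a w : Mat := a%:M + ec i0 *m w.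

Lemma scal_row_mul a b w z :
  scal_row a w * scal_row b z =
    scal_row (a * b) (a *: z + b *: w + w 0 i0 *: z).
Proof.
rewrite /scal_row -[LHS]/(_ *m _) mulmxDl !mulmxDr -scalar_mxM mul_scalar_mx.
rewrite mul_mx_scalar -mulmxA [w *m _]mulmxA mul_row_col mul_scalar_mx.
by rewrite -!scalemxAr !addrA.
Qed.

Lemma scal_row_1 : scal_row 1 0 = 1.
Proof. by rewrite /scal_row mulmx0 addr0. Qed.

Lemma scal_row_entry a w i j :
  scal_row a w i j = a *+ (i == j) + w 0 j *+ (i == i0).
Proof. by rewrite !mxE big_ord1 !mxE andbT mulr_natl. Qed.

Lemma scal_row_inj a w z : scal_row a w = scal_row a z -> w = z.
Proof.
move=> /matrixP e; apply/matrixP => i j; rewrite ord1.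
by have := e i0 j; rewrite !scal_row_entry eqxx => /addrI.
Qed.

Lemma scal_row_col a w u : scal_row a w *m u = a *: u + (w *m u) 0 0 *: ec i0.
Proof.
rewrite mulmxDl mul_scalar_mx -mulmxA; congr (_ + _).
by rewrite {1}[w *m u]mx11_scalar mul_mx_scalar.
Qed.

Lemma scal_row_inv w : 1 + w 0 i0 != 0 ->
  scal_row 1 w * scal_row 1 (- (1 + w 0 i0)^-1 *: w) = 1.
Proof.
move=> nz; rewrite scal_row_mul mulr1 !scale1r scalerA.
rewrite addrC addrA -scalerDl -[X in _ + X]scale1r -scalerDl.
rewrite (_ : _ + 1 = 0) ?scale0r ?scal_row_1 //.
by field.
Qed.

Lemma scal_row_unit w : 1 + w 0 i0 != 0 -> scal_row 1 w \is a GRing.unit.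
Proof. by move/scal_row_inv => /mulmx1_unit[]. Qed.

Lemma scal_row_unit_neq0 a w : scal_row a w \is a GRing.unit -> a + w 0 i0 != 0.
Proof.
move=> ur; apply/eqP => aw0; have : scal_row a w *m ec i0 = 0.
  by rewrite scal_row_col mul_row_col mxE eqxx mulr1n -scalerDl aw0 scale0r.
move/(congr1 (mulmx (scal_row a w)^-1)); rewrite mulKmx // mulmx0.
by move/matrixP/(_ i0 0)/eqP; rewrite !mxE !eqxx oner_eq0.
Qed.

Lemma halfB_scal_row w u v :
  halfB (scal_row 1 w *m u) (scal_row 1 w *m v) = halfB u v.
Proof.
rewrite !scal_row_col !scale1r halfBDl !halfBDr !halfBZl !halfBZr.
rewrite !halfB_deltal !halfB_deltar idx0E ltnn /= !mulr0.
by rewrite !addr0.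
Qed.

Lemma U_scal_row w : 1 + w 0 i0 != 0 -> U (scal_row 1 w).
Proof.
move=> w0; apply: (@U_halfB _ (fun _ _ => 0)); first exact: scal_row_unit.
by move=> u v; rewrite halfB_scal_row rmorph0 mulr0 subr0 addr0.
Qed.

Lemma conj_scal_row g a w t : g \is a GRing.unit -> g *m ec i0 = t *: ec i0 ->
  g * scal_row a w * g^-1 = scal_row a (t *: (w *m g^-1)).
Proof.
move=> ug ge; rewrite /scal_row mulrDr mulrDl.
have -> : g * a%:M = a%:M * g by exact: scalar_mxC.
rewrite mulrK //; congr (_ + _).
by rewrite -[LHS]/(_ *m _ *m _) mulmxA ge -!scalemxAl -scalemxAr mulmxA.
Qed.

Lemma inv_e0 g t : g \is a GRing.unit -> g *m ec i0 = t *: ec i0 ->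
  [/\ t != 0 & g^-1 *m ec i0 = t^-1 *: ec i0].
Proof.
move=> ug ge.
have e : ec i0 = t *: (g^-1 *m ec i0) by rewrite scalemxAr -ge mulKmx.
have t0 : t != 0.
  apply/eqP => t0; move/matrixP/(_ i0 0)/eqP: e.
  by rewrite t0 scale0r !mxE !eqxx oner_eq0.
by split=> //; rewrite {2}e scalerA mulVf // scale1r.
Qed.

(** These isometries g send [scal_row a w] to [scal_row a (w *m g)] under
    conjugation by their inverses, without a scalar factor. *)
Definition U_fix : set Mat := U `&` [set g | g *m ec i0 = ec i0].

Lemma U_fix1 : U_fix 1.
Proof.
rewrite -scal_row_1; split; last by rewrite /= scal_row_1 mul1mx.
by apply: U_scal_row; rewrite mxE addr0 oner_eq0.
Qed.

Lemma U_fix_mul g h : U_fix g -> U_fix h -> U_fix (g * h).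
Proof.
move=> [Ug ge] [Uh he]; split; first exact: U_mul.
by rewrite /= -[g * h]/(g *m h) -mulmxA he.
Qed.

Lemma U_fix_inv g : U_fix g -> U_fix g^-1.
Proof.
move=> [Ug ge]; split; first exact: U_inv.
by rewrite /= -{1}ge mulKmx //; case: Ug.
Qed.

Lemma conj_scal_row_fix a w g :
  U_fix g -> conj_by U (scal_row a w) (scal_row a (w *m g)).
Proof.
move=> fg; have [Ug' ge] := U_fix_inv fg; exists g^-1 => //.
rewrite (@conj_scal_row _ _ _ 1) ?scale1r //; last exact: U_unit.
by rewrite invrK.
Qed.

Lemma U_fix_Tshort i j x : hb i -> hb j -> i != j -> i != rev_ord j ->
  U_fix (Tshort F i j x).
Proof.
move=> hi hj ij irj; split; first exact: U_Tshort.
rewrite /= Tshort_col !mxE (negPf hj) rev_eq rev_idx0 (negPf hi).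
by rewrite !mulr0 !scale0r subr0 addr0.
Qed.

Lemma U_fix_scal_row k x : hb k -> U_fix (scal_row 1 (x *: er k)).
Proof.
move=> hk; have wk : (x *: er k) 0 i0 = 0.
  by rewrite !mxE [i0 == k]eq_sym (negPf hk) andbF mulr0.
split; first by apply: U_scal_row; rewrite wk addr0 oner_eq0.
by rewrite /= scal_row_col scale1r mul_row_col wk mxE mul0rn scale0r addr0.
Qed.

(** * Differences within an orbit of rows *)

Hypothesis n_gt2 : (2 < n)%N.

Lemma exists_hb_neq j : exists2 k, hb k & (k != j) && (k != rev_ord j).
Proof.
have [o0 o1] : (0 < n.*2.+1 /\ 1 < n.*2.+1)%N by rewrite -addnn; lia.
have [nj|] := boolP ((Ordinal o0 != j) && (Ordinal o0 != rev_ord j)).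
  by exists (Ordinal o0) => //; rewrite hbE /= (leq_ltn_trans _ n_gt2).
move=> cj; exists (Ordinal o1); first by rewrite hbE /= (leq_ltn_trans _ n_gt2).
move: cj; rewrite -!val_eqE /=; have := ltn_ord j; lia.
Qed.

(** If the entries k and -k of w vanish for some k away from j and -j, another
    nonzero entry p of w can be copied to k: by T_pk(1), or by T_(-k)(1,0) in
    the case p = 0. *)
Lemma row_entry_neq0 w j : w != 0 -> exists g k,
  [/\ U_fix g, hb k, k != j, k != rev_ord j & (w *m g) 0 k != 0].
Proof.
move=> w0; have [k hk /andP[kj krj]] := exists_hb_neq j.
have [wk0|wk] := eqVneq (w 0 k) 0; last first.
  by exists 1, k; rewrite mulmx1; split=> //; apply: U_fix1.
have [wrk0|wrk] := eqVneq (w 0 (rev_ord k)) 0; last first.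
  exists 1, (rev_ord k).
  rewrite mulmx1 hb_rev rev_eq krj (inj_eq rev_ord_inj) kj.
  by split=> //; apply: U_fix1.
have /rV0Pn[p wp] := w0.
have [pi0|hp] := eqVneq p i0.
  exists (scal_row 1 (1 *: er k)), k; split=> //; first exact: U_fix_scal_row.
  rewrite mulmxDr mulmx1 mulmxA mul_row_col mul_scalar_mx !mxE wk0 !eqxx.
  by rewrite add0r !mulr1 -pi0.
have pk : p != k by apply: contraNneq wp => ->; rewrite wk0.
have prk : p != rev_ord k by apply: contraNneq wp => ->; rewrite wrk0.
exists (Tshort F p k 1), k; split=> //; first exact: U_fix_Tshort.
rewrite row_Tshort !mxE wk0 wrk0 !eqxx mulr0 mul0r subr0 add0r mul1r mulr1.
exact: wp.
Qed.

(** Any multiple of a basis row is a difference of two elements of the orbit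
    of a nonzero row: move the row until its entry of index -j vanishes and
    another entry k, away from j and -j, does not; then T_kj only changes
    the entry of index j. *)
Lemma row_orbit_diff w j x : w != 0 -> hb j -> exists g h,
  [/\ U_fix g, U_fix h & w *m h = w *m g + x *: er j].
Proof.
move=> w0 hj; have [g [k [Ug hk kj krj uk]]] := row_entry_neq0 j w0.
have [r wg] : exists r, w *m g = r by exists (w *m g).
rewrite wg in uk.
have nkj := negPf kj; have nkrj := negPf krj.
(* s clears the entry -j by means of the entry k. *)
pose s := Tshort F k (rev_ord j) (- (r 0 (rev_ord j) / r 0 k)).
have Us : U_fix s by apply: U_fix_Tshort; rewrite ?hb_rev ?rev_ordK.
pose v := r *m s.
have vk : v 0 k = r 0 k.
  rewrite /v row_Tshort !mxE nkrj.
  rewrite [k == rev_ord k]eq_sym (negPf (hb_rev_neq hk)).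
  by rewrite !mulr0 subr0 addr0.
have vrj : v 0 (rev_ord j) = 0.
  rewrite /v row_Tshort !mxE !eqxx (inj_eq rev_ord_inj) [j == k]eq_sym nkj.
  by rewrite !mulr0 subr0 mulr1 mulNr divfK // addrN.
pose t := Tshort F k j (x / v 0 k).
have Ut : U_fix t by apply: U_fix_Tshort.
exists (g * s), (g * s * t); split; do ?[by do ?apply: U_fix_mul].
have wgs : w *m (g * s) = v by rewrite mulmxA wg.
have -> : w *m (g * s * t) = v *m t by rewrite -wgs -[RHS]mulmxA.
rewrite wgs.
by rewrite row_Tshort vrj mulr0 scale0r subr0 divfK // vk.
Qed.

(** * The conjugacy classes of level (0, K x 0) *)

Local Notation Kx0 := ([set: K] `*` [set 0] : set (K * K)).
Local Notation T := (extra_short_transvections F n Kx0).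
Local Notation Urel0 := (Urel F n [set 0] Kx0).
Local Notation CU0 := (CU F n [set 0] Kx0).
Local Notation EU0 := (EU F n [set 0] Kx0).

Lemma TextraE i x y :
  Textra F i x y =
    1 + x *: delta_mx i0 (rev_ord i) + y *: delta_mx i (rev_ord i).
Proof. by rewrite /Textra mu0 mulr0 scale0r subr0. Qed.

Lemma scal_row_Textra k x : Textra F k x 0 = scal_row 1 (x *: er (rev_ord k)).
Proof. by rewrite TextraE scale0r addr0 /scal_row -scalemxAr mul_delta_mx. Qed.

Lemma sgn_setKx0 k x y : sgn_set F Kx0 (- eps k) (x, y) <-> y = 0.
Proof.
rewrite /sgn_set; case: ifP => _; split=> [[_ /eqP]|->] /=.
- by move/eqP.
- by [].
- by rewrite bar_eq0 => /eqP.
- by rewrite rmorph0.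
Qed.

Lemma TP t : T t <-> exists k x, hb k /\ t = scal_row 1 (x *: er k).
Proof.
split=> [[i [x [y [hi /sgn_setKx0 -> ->]]]]|[k [x [hk ->]]]].
  by exists (rev_ord i), x; rewrite hb_rev scal_row_Textra.
exists (rev_ord k), x, 0; split; rewrite ?hb_rev ?scal_row_Textra ?rev_ordK //.
exact/sgn_setKx0.
Qed.

Lemma nontrivial_TP t : nontrivial_extra_short F n Kx0 t <->
  exists k x, [/\ hb k, x != 0 & t = scal_row 1 (x *: er k)].
Proof.
split=> [[/TP[k [x [hk ->]]] ne]|[k [x [hk x0 tE]]]].
  exists k, x; split=> //; apply: contra_notN ne => /eqP ->.
  by rewrite scale0r scal_row_1.
split; first by apply/TP; exists k, x.
rewrite tE -scal_row_1 => /scal_row_inj/matrixP/(_ 0 k)/eqP.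
by rewrite !mxE !eqxx mulr1 (negPf x0).
Qed.

(** The stabiliser of the radical: conjugation by its elements permutes the
    [scal_row a w], and it visibly contains the generators of E. *)
Definition stab0 : set Mat :=
  [set g | g \is a GRing.unit /\ exists t, g *m ec i0 = t *: ec i0].

Lemma stab0_subgroup : is_subgroup stab0.
Proof.
split=> [g []|||] //.
- by split; [apply: unitr1|exists 1; rewrite mul1mx scale1r].
- move=> g h [ug [a ga]] [uh [b he]]; split; first by rewrite unitrMr.
  by exists (b * a); rewrite -[g * h]/(g *m h) -mulmxA he -scalemxAr ga scalerA.
- move=> g [ug [a ga]]; split; first by rewrite unitrV.
  by exists a^-1; case: (inv_e0 ug ga).
Qed.

Lemma U_stab0 : U `<=` stab0.
Proof. by move=> g Ug; split; [apply: U_unit|apply: U_e0]. Qed.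

Lemma E_gens_stab0 :
  short_transvections F n setT `|` extra_short_transvections F n Delta
    `<=` stab0.
Proof.
move=> t [[i [j [x [[hi hj ij irj] [_ ->]]]]]|[k [x [y [hk _ ->]]]]].
  exact/U_stab0/U_Tshort.
have Tmul a b c d :
    Textra F k a b *m Textra F k c d = Textra F k (a + c) (b + d).
  rewrite !TextraE !mulmxDl !mulmxDr !mul1mx !mulmx1 -!scalemxAl -!scalemxAr.
  rewrite !mul_delta_mx_cond rev_eq rev_idx0 (negPf hk) (negPf (hb_rev_neq hk)).
  by rewrite !mulr0n !scaler0 !addr0; apply/matrixP => p q; rewrite !mxE; ring.
split.
  suff: Textra F k (- x) (- y) *m Textra F k x y = 1%:M by case/mulmx1_unit.
  by rewrite Tmul !addNr TextraE !scale0r !addr0.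
exists 1; rewrite TextraE !mulmxDl -!scalemxAl !mul_delta_mx_cond.
by rewrite rev_eq rev_idx0 (negPf hk) !mulr0n !scaler0 !addr0 mul1mx scale1r.
Qed.

Lemma E_subgroup : is_subgroup E.
Proof. by apply: gen_subgroup => g /E_gens_stab0[]. Qed.

Lemma E_stab0 : E `<=` stab0.
Proof.
by apply: smallest_sub => //; [apply: stab0_subgroup|apply: E_gens_stab0].
Qed.

Lemma T_E : T `<=` E.
Proof.
move=> _ [k [x [y [hk /sgn_setKx0 -> ->]]]]; apply: sub_gen_smallest; right.
exists k, x, 0; split=> //; rewrite /sgn_set; case: ifP => _ /=;
by rewrite ?rmorph0; apply: Delta_horizontal.
Qed.

Lemma UrelP s : Urel0 s <-> exists2 w : Row, 1 + w 0 i0 != 0 & s = scal_row 1 w.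
Proof.
split=> [[Us sP _]|[w w0 ->]].
  have [t st] := U_e0 Us.
  have sE : s = scal_row 1 (row i0 s - er i0).
    apply/matrixP => i j; rewrite scal_row_entry !mxE eqxx /= [j == i0]eq_sym.
    have [->|hi] := eqVneq i i0; first by rewrite mulr1n addrCA subrr addr0.
    rewrite mulr0n addr0; have [->|hj] := eqVneq j i0.
      rewrite (negPf hi); move/matrixP/(_ i 0): st.
      by rewrite -colE !mxE (negPf hi) mulr0 mulr0n.
    by have /eqP := sP i j hi hj; rewrite subr_eq0 => /eqP.
  exists (row i0 s - er i0) => //.
  by apply: scal_row_unit_neq0; rewrite -sE; apply: U_unit.
split=> [|i j hi hj|u _]; first exact: U_scal_row.
  by rewrite scal_row_entry (negPf hi) mulr0n addr0 subrr.
rewrite hsubE /formQ /= -/(halfB _ _) -/(halfB _ _) halfB_scal_row.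
by split=> //=; rewrite subrr.
Qed.

Lemma Urel_unit s : Urel0 s -> s \is a GRing.unit.
Proof. by case=> Us _ _; apply: U_unit. Qed.

Lemma Urel_subgroup : is_subgroup Urel0.
Proof.
split=> [s /Urel_unit||s t us ut|s /UrelP[w w0 sE]] //.
- by apply/UrelP; exists 0; rewrite ?scal_row_1 // mxE addr0 oner_eq0.
- move: (us) (ut) => /UrelP[w w0 sE] /UrelP[z z0 tE].
  have ust : s * t \is a GRing.unit by rewrite unitrMr ?Urel_unit.
  move: ust; rewrite sE tE scal_row_mul mulr1 => ust.
  by apply/UrelP; eexists; [exact: scal_row_unit_neq0 ust|].
- have sK := scal_row_inv w0; rewrite -sE in sK.
  have us : s \is a GRing.unit by rewrite sE scal_row_unit.
  have sV : s^-1 = scal_row 1 (- (1 + w 0 i0)^-1 *: w).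
    by rewrite -[LHS]mulr1 -sK mulKr.
  apply/UrelP; eexists; [|exact: sV].
  by apply: scal_row_unit_neq0; rewrite -sV unitrV.
Qed.

Lemma Urel_conj g s : stab0 g -> Urel0 s -> Urel0 (g * s * g^-1).
Proof.
move=> [ug [t ge]] us; have := Urel_unit us; move/UrelP: us => [w w0 ->] us.
have uc : g * scal_row 1 w * g^-1 \is a GRing.unit.
  by rewrite unitrMr ?unitrV // unitrMr.
rewrite (conj_scal_row _ _ ug ge) in uc *.
by apply/UrelP; eexists; [exact: scal_row_unit_neq0 uc|].
Qed.

Lemma Urel_sub_CU : Urel0 `<=` CU0.
Proof.
move=> s us; have [_ _ mulU invU] := Urel_subgroup.
have Us : U s by case: us.
have ss : stab0 s by apply: U_stab0.
split; first split=> //.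
  apply/seteqP; split=> [_ [h uh <-]|h uh]; first exact: Urel_conj.
  have sk : s \is a GRing.unit by case: ss.
  exists (s^-1 * h * s); last by rewrite !mulrA mulrV // mul1r mulrK.
  by apply: (mulU _ _ _ us); apply: mulU => //; apply: invU.
apply: smallest_sub; first exact: Urel_subgroup.
move=> _ [y Ey <-]; rewrite -!mulrA; apply: mulU => //; rewrite mulrA.
by apply: Urel_conj; [apply: E_stab0|apply: invU].
Qed.

Lemma odd_form_ideal_Kx0 : is_odd_form_ideal F [set 0] Kx0.
Proof.
have Kx0_sub : is_hsubgroup F Kx0.
  split=> // [[a b] [c d] [_ /= ->] [_ /= ->]|[a b] [_ /= ->]]; split=> //=.
    by rewrite mu0 mulr0 mul0r addr0 subr0.
  by rewrite mu0 mulr0 mul0r oppr0 addr0.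
split.
- split=> // [x y /= -> ->|c x /= ->]; first by rewrite addr0.
  by rewrite mulr0.
- by move=> x /= ->; rewrite rmorph0.
- by split=> // [[a b] c [_ /= ->]]; split=> //=; rewrite mulr0 mul0r.
- move=> _ [_ [x /= -> <-]] [b hb <-].
  have : Kx0 b.
    apply: hb; split=> // _ [c _ [d /= -> <-]].
    by split=> //=; rewrite mulr0.
  case: b {hb} => b1 b2 [_ /= ->]; split=> //=.
  by rewrite !rmorph0 !mul0r !subr0 addr0.
- move=> [a b] [_ /= b0]; split.
    by apply: Delta_horizontal; rewrite b0.
  by split=> //= y _; rewrite mu0 mulr0 mul0r.
Qed.

Lemma T_EU : T `<=` EU0.
Proof.
by move=> t Tt; apply: sub_gen_smallest; apply: sub_gen_smallest; right.
Qed.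

Lemma short0 t : short_transvections F n [set 0] t -> t = 1.
Proof.
case=> i [j [x [_ [/= -> ->]]]].
by rewrite /Tshort rmorph0 mulr0 mul0r !scale0r subr0 addr0.
Qed.

(** The group generated by the T_i(x,0). As E normalises it, it is also their
    normal closure in E. *)
Definition row_group : set Mat :=
  [set scal_row 1 z | z in [set z : Row | z 0 i0 = 0]].

Lemma row_group_sub H : is_subgroup H -> T `<=` H -> row_group `<=` H.
Proof.
move=> [_ H1 Hmul _] TH _ [z /= z0 <-].
suff [] : (z 0 i0 = 0 /\ H (scal_row 1 z)) by [].
rewrite [z]row_sum_delta.
elim/big_rec: _ => [|j v _ [v0 Hv]]; first by rewrite mxE scal_row_1.
have [->|hj] := eqVneq j i0; first by rewrite z0 scale0r add0r.
have e0 : (z 0 j *: er j) 0 i0 = 0.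
  by rewrite !mxE [i0 == j]eq_sym (negPf hj) andbF mulr0.
split; first by rewrite mxE e0 v0 addr0.
have : H (scal_row 1 v * scal_row 1 (z 0 j *: er j)).
  by apply: Hmul => //; apply: TH; apply/TP; exists j, (z 0 j).
by rewrite scal_row_mul mulr1 !scale1r v0 scale0r addr0.
Qed.

Lemma row_group_subgroup : is_subgroup row_group.
Proof.
have u1 z : z 0 i0 = 0 -> 1 + z 0 i0 != 0 by move=> ->; rewrite addr0 oner_eq0.
have mulR w z : w 0 i0 = 0 -> scal_row 1 w * scal_row 1 z = scal_row 1 (z + w).
  by move=> w0; rewrite scal_row_mul mulr1 !scale1r w0 scale0r addr0.
split=> [_ [z z0 <-]||_ _ [w w0 <-] [z z0 <-]|_ [z z0 <-]].
- exact/scal_row_unit/u1.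
- by exists 0; rewrite ?scal_row_1 //= mxE.
- by rewrite mulR //; exists (z + w) => //=; rewrite mxE z0 w0 addr0.
- exists (- z) => /=; first by rewrite mxE z0 oppr0.
  rewrite -[RHS]mulr1 -scal_row_1 -(addNr z) -mulR // mulKr //.
  by rewrite scal_row_unit ?u1.
Qed.

Lemma EU_sub H : is_subgroup H -> T `<=` H -> EU0 `<=` H.
Proof.
move=> gH TH; apply: subset_trans (row_group_sub gH TH).
apply: smallest_sub.
  split; first exact: row_group_subgroup.
    by apply: row_group_sub; [apply: E_subgroup|apply: T_E].
  move=> y /E_stab0[uy [t ye]] _ [_ [z z0 <-] <-].
  rewrite (conj_scal_row _ _ uy ye); eexists; [|reflexivity].
  have [t0 yVe] := inv_e0 uy ye.
  have e : ((z *m y^-1) *m ec i0) 0 0 = (z *m y^-1) 0 i0.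
    by rewrite mul_row_col mxE.
  rewrite /= mxE -e -mulmxA yVe -scalemxAr mul_row_col /= !mxE.
  by rewrite z0 mul0rn !mulr0.
apply: smallest_sub; first exact: row_group_subgroup.
move=> t [/short0 ->|/TP[k [x [hk ->]]]].
  by case: row_group_subgroup.
exists (x *: er k) => //=.
by rewrite !mxE [i0 == k]eq_sym (negPf hk) andbF mulr0.
Qed.

(** The hyperbolic block of s commutes with those of all T_kl(1): comparing the
    entries of index (p,l) of s T_kl(1) and T_kl(1) s gives s_pk = 0 if p is
    neither k nor -l, and s_kk = s_ll. *)
Lemma CU_scal_row s : CU0 s -> exists a w, s = scal_row a w.
Proof.
move=> [[Us _] comm_s].
have us := U_unit Us; have [t st] := U_e0 Us.
have commE (y : Mat) p q : E y -> hb p -> (s * y) p q = (y * s) p q.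
  move=> Ey hp; have [uy _] := E_stab0 Ey.
  have /UrelP[w _ ew] : Urel0 (s * y * s^-1 * y^-1).
    by apply: comm_s; apply: sub_gen_smallest; exists y.
  have -> : s * y = scal_row 1 w * (y * s).
    by rewrite -ew !mulrA mulrVK // mulrVK.
  rewrite -[scal_row 1 w * _]/(scal_row 1 w *m (y * s)).
  rewrite /scal_row mulmxDl mul1mx -mulmxA.
  by rewrite !mxE big_ord1 !mxE (negPf hp) mul0r addr0.
have comm_short k l p : hb k -> hb l -> k != l -> k != rev_ord l -> hb p ->
    s p k = s l l *+ (p == k)
      - opp_coef k l 1 * s (rev_ord k) l *+ (p == rev_ord l).
  move=> hk hl kl krl hp.
  have Ekl : E (Tshort F k l 1).
    by apply: sub_gen_smallest; left; exists k, l, 1.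
  have := commE _ p l Ekl hp.
  have -> : (s * Tshort F k l 1) p l = s p l + s p k.
    have -> : (s * Tshort F k l 1) p l = (row p s *m Tshort F k l 1) 0 l.
      by rewrite -row_mul [RHS]mxE.
    rewrite row_Tshort !mxE !eqxx /= [l == rev_ord k]eq_sym rev_eq (negPf krl).
    by rewrite mul1r mulr1 !mulr0 subr0.
  have -> : (Tshort F k l 1 * s) p l = (Tshort F k l 1 *m col l s) p 0.
    rewrite [RHS]mxE [LHS]mxE; apply: eq_bigr => i _.
    by rewrite [col l s i 0]mxE.
  rewrite Tshort_col !mxE !andbT mul1r -addrA => /addrI ->.
  by rewrite !mulr_natr.
(* Either l or -l can serve as the auxiliary index. *)
have offdiag p k : hb p -> hb k -> p != k -> s p k = 0.
  move=> hp hk pk; have [l hl /andP[lk lrk]] := exists_hb_neq k.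
  have aux l' : hb l' -> l' != k -> l' != rev_ord k -> p != rev_ord l' ->
      s p k = 0.
    move=> hl' l'k l'rk prl.
    rewrite (comm_short k l') ?(negPf pk) ?(negPf prl) //.
    - by rewrite !mulr0n subr0.
    - by rewrite eq_sym.
    - by rewrite eq_sym rev_eq.
  have [pl|] := eqVneq p (rev_ord l); last exact: aux.
  apply: (aux (rev_ord l)); rewrite ?hb_rev ?rev_eq ?rev_ordK //.
  by rewrite pl hb_rev_neq.
have diag k l : hb k -> hb l -> k != l -> k != rev_ord l -> s k k = s l l.
  move=> hk hl kl krl; rewrite (comm_short k l) // eqxx (negPf krl).
  by rewrite mulr0n subr0.
have [k hk _] := exists_hb_neq i0.
(* The indices p and -p are compared through a third index l. *)
have diagk p : hb p -> s p p = s k k.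
  move=> hp; have [l hl /andP[lp lrp]] := exists_hb_neq p.
  have [->//|pk] := eqVneq p k.
  have [prk|prk] := eqVneq p (rev_ord k); last exact: diag.
  have [pl prl] : p != l /\ p != rev_ord l by rewrite eq_sym lp eq_sym rev_eq.
  rewrite (diag p l) //.
  by apply: diag => //; [rewrite -[k]rev_ordK -prk|rewrite -prk].
exists (s k k), (row i0 s - s k k *: er i0); apply/matrixP => p q.
rewrite scal_row_entry !mxE eqxx /= [q == i0]eq_sym.
have [->|hp] := eqVneq p i0; first by rewrite mulr1n mulr_natr [RHS]addrC subrK.
rewrite mulr0n addr0; have [<-|pq] := eqVneq p q; first by rewrite diagk.
rewrite mulr0n; have [->|hq] := eqVneq q i0; last exact: offdiag.
move/matrixP/(_ p 0): st.
by rewrite -colE !mxE (negPf hp) mulr0.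
Qed.

(** Multiplication by [scal_row 1 z] from the left shifts the row of
    [scal_row a w] by a z, provided that z vanishes at 0. *)
Lemma class_quotient C a w :
    U (scal_row a w) -> C = conj_by U (scal_row a w) -> w != 0 ->
  forall t, T t -> exists c d : Mat, [/\ C c, C d & t = c * d^-1].
Proof.
move=> Us -> w0 t /TP[j [x [hj ->]]].
have [g [h [Ug Uh e]]] := row_orbit_diff (a * x) w0 hj.
have Cg := conj_scal_row_fix a w Ug; have Ch := conj_scal_row_fix a w Uh.
have ud : scal_row a (w *m g) \is a GRing.unit.
  by case: Cg => k Uk <-; rewrite unitrMr ?unitrV ?unitrMr ?U_unit.
exists (scal_row a (w *m h)), (scal_row a (w *m g)); split=> //.
have -> : scal_row a (w *m h) = scal_row 1 (x *: er j) * scal_row a (w *m g).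
  rewrite scal_row_mul mul1r scale1r e scalerA !mxE [i0 == j]eq_sym (negPf hj).
  by rewrite andbF mulr0 scale0r addr0.
by rewrite mulrK.
Qed.

Lemma class_unit s C :
  U s -> C = conj_by U s -> C `<=` [set x | x \is a GRing.unit].
Proof.
by move=> Us -> _ [g Ug <-] /=; rewrite unitrMr ?unitrV ?unitrMr ?U_unit.
Qed.

(** The case w = 0 is excluded because the class then generates central
    elements only, whereas T_i(1,0) does not commute with the matrix unit
    e^{-i,-i}. *)
Lemma class_of_levelP C : classes_of_level F n [set 0] Kx0 C ->
  exists a w, [/\ w != 0, U (scal_row a w) & C = conj_by U (scal_row a w)].
Proof.
move=> [[s Us CE] [_ EU_C C_CU]].
have Cs : C s.
  by rewrite CE; exists 1; rewrite ?invr1 ?mulr1 ?mul1r //; case: U_fix1.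
have [a [w sE]] := CU_scal_row (C_CU _ (sub_gen_smallest Cs)).
exists a, w; split; last 2 first; [by rewrite -sE..|].
apply/eqP => w0.
have {w w0} sE : s = a%:M by rewrite sE w0 /scal_row mulmx0 addr0.
pose Z : set Mat :=
  [set g | g \is a GRing.unit /\ forall h : Mat, GRing.comm h g].
have Zgr : is_subgroup Z.
  split=> [g []||g h [ug cg] [uh ch]|g [ug cg]] //.
  - by split=> [|h]; [apply: unitr1|apply: commr1].
  - by split=> [|k]; [rewrite unitrMr|apply: commrM].
  - by split=> [|k]; [rewrite unitrV|apply: commrV].
have CZ : C `<=` Z.
  have comm_s (h : Mat) : h * s = s * h by rewrite sE; apply: scalar_mxC.
  rewrite CE => _ [g Ug <-]; have ug := U_unit Ug.
  by rewrite comm_s mulrK //; split; [apply: U_unit|].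
have [k hk _] := exists_hb_neq i0.
have [_ /(_ (delta_mx k k))] : Z (scal_row 1 (1 *: er k)).
  apply: (smallest_sub Zgr CZ); apply: EU_C; apply: T_EU; apply/TP.
  by exists k, 1.
move/matrixP/(_ i0 k).
rewrite -[_ * scal_row _ _]/(_ *m scal_row _ _).
rewrite -[scal_row _ _ * _]/(scal_row _ _ *m _).
rewrite /scal_row scale1r mul_delta_mx mulmxDl mulmxDr mul1mx mulmx1.
rewrite !mul_delta_mx_cond (negPf hk) eqxx mulr0n mulr1n addr0 !mxE !eqxx.
rewrite [i0 == k]eq_sym (negPf hk) /=.
by move/eqP; rewrite mulr0n add0r eq_sym oner_eq0.
Qed.

Lemma class_of_level_scal_row w : w != 0 -> 1 + w 0 i0 != 0 ->
  classes_of_level F n [set 0] Kx0 (conj_by U (scal_row 1 w)).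
Proof.
move=> w0 w1; have Us := U_scal_row w1; set C := conj_by _ _.
have Cunit := class_unit Us (erefl C).
have Cgr := gen_subgroup Cunit; have [_ _ mulC invC] := Cgr.
split; first by exists (scal_row 1 w).
split; first exact: odd_form_ideal_Kx0.
  apply: EU_sub => // t /(class_quotient Us (erefl C) w0)[c [d [Cc Cd ->]]].
  by apply: mulC; [|apply: invC]; apply: sub_gen_smallest.
apply: subset_trans Urel_sub_CU.
apply: smallest_sub; first exact: Urel_subgroup.
move=> _ [g Ug <-]; apply: Urel_conj; first exact: U_stab0.
by apply/UrelP; exists w.
Qed.

Local Notation D := (classes_of_level F n [set 0] Kx0).
Local Notation NT := (nontrivial_extra_short F n Kx0).

Lemma nontrivial_T : NT `<=` T.
Proof. by move=> t []. Qed.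

Lemma scn_le2 C : D C -> (scn C NT <= 2%:Z%:E)%E.
Proof.
move/class_of_levelP=> [a [w [w0 Us CE]]]; apply: cn_le => // t /nontrivial_T.
case/(class_quotient Us CE w0) => c [d [Cc Cd ->]].
by apply: pow_set2; [left|right; exists d].
Qed.

(** The corner entry is the scalar by which an isometry acts on the radical,
    hence invariant under conjugation. *)
Lemma conj_scal_row_corner g w :
  U g -> (g * scal_row 1 w * g^-1) i0 i0 = 1 + w 0 i0.
Proof.
move=> Ug; have [t ge] := U_e0 Ug; have ug := U_unit Ug.
have [t0 ie] := inv_e0 ug ge.
rewrite (conj_scal_row _ _ ug ge) scal_row_entry eqxx !mulr1n; congr (_ + _).
rewrite mxE.
have -> : (w *m g^-1) 0 i0 = (w *m g^-1 *m ec i0) 0 0.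
  by rewrite mul_row_col [RHS]mxE.
by rewrite -mulmxA ie -scalemxAr mul_row_col !mxE /= mulr1n mulVKf.
Qed.

Lemma NT_inv t : NT t -> NT t^-1.
Proof.
case/nontrivial_TP=> k [x [hk x0 tE]]; apply/nontrivial_TP; exists k, (- x).
have e0 c : (c *: er k) 0 i0 = 0.
  by rewrite !mxE [i0 == k]eq_sym (negPf hk) andbF mulr0.
have tK : t * scal_row 1 (- x *: er k) = 1.
  rewrite tE scal_row_mul e0 mulr1 !scale1r scale0r addr0 -scalerDl addNr.
  by rewrite scale0r scal_row_1.
split; rewrite ?oppr_eq0 // -[LHS]mulr1 -tK mulKr //.
by rewrite tE; apply: scal_row_unit; rewrite e0 addr0 oner_eq0.
Qed.

Lemma NT_subset_class C : NT `<=` C `|` inv_set C -> exists2 t, NT t & C t.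
Proof.
move=> sub; have [k hk _] := exists_hb_neq i0.
have NTt : NT (scal_row 1 (1 *: er k)).
  by apply/nontrivial_TP; exists k, 1; rewrite oner_eq0.
case: (sub _ NTt) => [Ct|[s Cs sV]]; first by exists (scal_row 1 (1 *: er k)).
by exists s => //; rewrite -[s]invrK sV; apply: NT_inv.
Qed.

(** All elements of the class of diag(1, ..., c, ..., 1) have corner entry c. *)
Lemma class_scalar c : c != 0 -> c != 1 ->
  exists2 C, D C & (2%:Z%:E <= scn C NT)%E.
Proof.
move=> c0 c1; pose w : Row := (c - 1) *: er i0.
have wi0 : w 0 i0 = c - 1 by rewrite !mxE !eqxx mulr1.
have w0 : w != 0.
  by apply: contra_neq c1 => /rowP/(_ i0); rewrite wi0 mxE => /subr0_eq.
have w1 : 1 + w 0 i0 = c by rewrite wi0 addrC subrK.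
exists (conj_by U (scal_row 1 w)).
  by apply: class_of_level_scal_row; rewrite ?w1.
apply: cn_gt1 => /NT_subset_class[t /nontrivial_TP[k [x [hk _ tE]]] [g Ug gt]].
have := conj_scal_row_corner w Ug; rewrite w1 gt tE scal_row_entry eqxx !mulr1n.
rewrite !mxE [i0 == k]eq_sym (negPf hk) andbF mulr0 addr0 => /eqP.
by rewrite eq_sym (negPf c1).
Qed.

(** * The field with two elements *)

Section F2.
Hypothesis K2 : forall x : K, x = 0 \/ x = 1.

Lemma add_self x : x + x = 0.
Proof.
have [|e] := K2 (1 + 1); last first.
  by have := addrK 1 (1 : K); rewrite e subrr => /eqP; rewrite eq_sym oner_eq0.
by case: (K2 x) => -> //; rewrite addr0.
Qed.

Lemma opp_self x : - x = x.
Proof. by apply: (addrI x); rewrite subrr add_self. Qed.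

Lemma bar_id x : bar x = x.
Proof. by case: (K2 x) => ->; rewrite ?rmorph0 ?rmorph1. Qed.

Lemma lam1 : lam = 1.
Proof. by case: (K2 lam) => // /eqP; rewrite (negPf lam_neq0). Qed.

Lemma neq0_1 x : x != 0 -> x = 1.
Proof. by case: (K2 x) => -> //; rewrite eqxx. Qed.

Lemma form_sym u v : form u v = halfB u v + halfB v u.
Proof. by rewrite formBE lam1 mul1r bar_id. Qed.

(** The form identifies rows that vanish at 0 with columns modulo the radical:
    the row w = e_k + e_(-k) corresponds to the column v = e_k + e_(-k) and the
    row e_j to the column e_(-j). If an isometry g moved w to e_j, it would move
    v to e_(-j) up to the radical; but the quadratic form, which g preserves as
    Delta = K x 0, has the value 1 at v and 0 at e_(-j). *)
Lemma class_nonsingular : ~ Delta (0, 1) ->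
  exists2 C, D C & (2%:Z%:E <= scn C NT)%E.
Proof.
move=> D01; have o0 : (0 < n.*2.+1)%N by [].
have [k ltkn] : exists k : index, (k < n)%N.
  by exists (Ordinal o0); rewrite /=; lia.
have hk : hb k by rewrite hbE ltkn.
pose w : Row := er k + er (rev_ord k); pose v := ec k + ec (rev_ord k).
have w0 : w != 0.
  apply/eqP => /rowP/(_ k)/eqP; rewrite !mxE !eqxx /= [k == _]eq_sym.
  by rewrite (negPf (hb_rev_neq hk)) mulr0n addr0 oner_eq0.
have wi0 : w 0 i0 = 0.
  rewrite !mxE ![i0 == _]eq_sym rev_eq rev_idx0 (negPf hk) /=.
  by rewrite mulr0n addr0.
exists (conj_by U (scal_row 1 w)).
  by apply: class_of_level_scal_row; rewrite // wi0 addr0 oner_eq0.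
apply: cn_gt1 => /NT_subset_class[t /nontrivial_TP[j [x [hj x0 tE]]] [g Ug gt]].
have ug := U_unit Ug; have [c ge] := U_e0 Ug; have [c0 _] := inv_e0 ug ge.
have ltnk : (n < k)%N = false by rewrite ltnNge ltnW.
have halfBv u : halfB u v + halfB v u = (w *m u) 0 0.
  rewrite halfBDl halfBDr !halfB_deltal !halfB_deltar rev_ltn rev_gtn ltkn ltnk.
  by rewrite rev_ordK bar_id add0r addr0 mulmxDl -!rowE !mxE.
have halfBj u : halfB u (ec (rev_ord j)) + halfB (ec (rev_ord j)) u = u j 0.
  rewrite halfB_deltal halfB_deltar rev_ltn rev_gtn rev_ordK bar_id.
  move: hj; rewrite hbE => /orP[] ltj; rewrite ltj ltnNge ltnW //=.
    by rewrite addr0.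
  by rewrite add0r.
have wE : w = er j *m g.
  move: gt; rewrite (conj_scal_row _ _ ug ge) tE (neq0_1 x0) (neq0_1 c0).
  rewrite !scale1r.
  by move/scal_row_inj <-; rewrite mulmxKV.
pose r := g *m v + (- 1) *: ec (rev_ord j).
have rE : r = r i0 0 *: ec i0.
  apply: formB_radical => u; rewrite -[u](mulKVmx ug); set u' := _ *m u.
  rewrite form_sym /r halfBDl halfBDr halfBZr halfBZl !bar_id opp_self !mul1r.
  rewrite addrACA -form_sym; case: (Ug) => _ -> _.
  rewrite halfBj form_sym halfBv wE.
  by rewrite -mulmxA -rowE !mxE add_self.
have gv : g *m v = ec (rev_ord j) + r i0 0 *: ec i0.
  by rewrite -rE /r scaleN1r addrC subrK.
have qv : halfB v v = 1.
  rewrite halfBDl !halfB_deltal rev_ltn ltkn ltnk !mxE !eqxx.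
  by rewrite (negPf (hb_rev_neq hk)) /= mulr0n add0r addr0.
have qgv : halfB (g *m v) (g *m v) = 0.
  rewrite gv halfBDl !halfBDr !halfBZl !halfBZr !halfB_deltal.
  rewrite idx0E ltnn !mulr0 !addr0 rev_ordK !mxE !andbT (negPf hj).
  by rewrite [j == _]eq_sym (negPf (hb_rev_neq hj)) !if_same mulr0 addr0.
case: (Ug) => _ _ /(_ v); rewrite hsubE /= -/(halfB _ _) -/(halfB _ _) qv qgv.
rewrite add0r (opp_self 1); set y := _ - _ => Dy; apply: D01.
case: (Delta_submodule F) => -[_ Dadd _] _.
have Dx : Delta (- y, 0) by apply: Delta_horizontal.
by have := Dadd _ _ Dx Dy; rewrite /hadd /= addNr add0r mu0 mulr0 mul0r subr0.
Qed.

Section FullParameter.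
Hypothesis Delta01 : Delta (0, 1).

(** The column whose product with a row is the pairing of that row with w. *)
Definition flip w : M := \col_i w 0 (rev_ord i).

Lemma flipE w i : flip w i 0 = w 0 (rev_ord i).
Proof. by rewrite mxE. Qed.

Definition sympl w : Mat := 1 + flip w *m w.

Lemma form_flip w v : w 0 i0 = 0 -> form v (flip w) = (w *m v) 0 0.
Proof.
move=> w0; rewrite form_sym [RHS]mxE (bigID (fun i : index => (i < n)%N)) /=.
congr (_ + _).
  by apply: eq_bigr => i _; rewrite flipE rev_ordK bar_id mulrC.
rewrite (bigD1 i0) ?idx0E ?ltnn //= w0 mul0r add0r (reindex_inj rev_ord_inj) /=.
apply: eq_big => [i|i _]; last by rewrite flipE bar_id.
by rewrite -/(hb _) hb_rev hbE rev_ltn; case: ltngtP.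
Qed.

Lemma form_self v : form v v = 0.
Proof. by rewrite form_sym add_self. Qed.

Lemma U_fix_sympl w : w 0 i0 = 0 -> U_fix (sympl w).
Proof.
move=> w0; have symplE v : sympl w *m v = v + form v (flip w) *: flip w.
  by rewrite mulmxDl mul1mx -mulmxA [w *m v]mx11_scalar mul_mx_scalar form_flip.
have formDr u v v' c : form u (v + c *: v') = form u v + c * form u v'.
  by rewrite !form_sym halfBDl halfBDr halfBZl halfBZr bar_id; ring.
have formDl u u' v c : form (u + c *: u') v = form u v + c * form u' v.
  by rewrite !form_sym halfBDl halfBDr halfBZl halfBZr bar_id; ring.
have formC u v : form u v = form v u by rewrite !form_sym addrC.
split; last first.
  by rewrite /= symplE form_flip // mul_row_col w0 mxE mul0rn scale0r addr0.
have symplK : sympl w *m sympl w = 1%:M.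
  rewrite /sympl mulmxDr mulmx1 mulmxDl mul1mx -[flip w *m w *m _]mulmxA.
  rewrite [w *m _]mulmxA [w *m flip w]mx11_scalar -form_flip // form_self.
  rewrite mul_scalar_mx scale0r mulmx0 addr0 -addrA.
  rewrite (_ : flip w *m w + _ = 0) ?addr0 //.
  by apply/matrixP => p q; rewrite [LHS]mxE add_self mxE.
split; first by case/mulmx1_unit: symplK.
  move=> u v; rewrite !symplE formDl !formDr form_self mulr0 addr0.
  by rewrite (formC (flip w) v) -addrA [form v _ * _]mulrC add_self addr0.
move=> u; set d := hsub _ _ _; case: d => x y; apply: Delta_hadd.
case: (K2 y) => -> //; exact: Delta_horizontal.
Qed.

Lemma row_sympl z w : z *m sympl w = z + (z *m flip w) 0 0 *: w.
Proof.
by rewrite mulmxDr mulmx1 mulmxA {1}[z *m flip w]mx11_scalar mul_scalar_mx.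
Qed.

Lemma row_add_self w : w + w = 0.
Proof. by apply/matrixP => p q; rewrite !mxE add_self. Qed.

(** As w pairs to 1 with w + z, the transvection of w + z adds w + z to w. *)
Lemma sympl_move w z : w 0 i0 = 0 -> z 0 i0 = 0 -> (w *m flip z) 0 0 = 1 ->
  exists2 g, U_fix g & w *m g = z.
Proof.
move=> w0 z0 wz; exists (sympl (w + z)).
  by apply: U_fix_sympl; rewrite mxE w0 z0 addr0.
have flipD : flip (w + z) = flip w + flip z by apply/colP => i; rewrite !mxE.
have ww : (w *m flip w) 0 0 = 0 by rewrite -form_flip // form_self.
rewrite row_sympl flipD mulmxDr mxE ww wz add0r scale1r addrA row_add_self.
by rewrite add0r.
Qed.

Lemma mul_flip_delta w k : (w *m flip (er k)) 0 0 = w 0 (rev_ord k).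
Proof.
rewrite (_ : flip (er k) = ec (rev_ord k)) ?mul_row_col ?mxE //.
by apply/colP => i; rewrite !mxE rev_eq andbT.
Qed.

(** Both w and e_j have pairing 1 with a common row z, so that two symplectic
    transvections lead from w through z to e_j. *)
Lemma sympl_transitive w j : w != 0 -> w 0 i0 = 0 -> hb j ->
  exists2 g, U_fix g & w *m g = er j.
Proof.
move=> w0 wi0 hj; have er0 k : hb k -> er k 0 i0 = 0.
  by move=> hk; rewrite !mxE [i0 == k]eq_sym (negPf hk).
suff [z [zi0 wz zj]] : exists z : Row,
    [/\ z 0 i0 = 0, (w *m flip z) 0 0 = 1 & z 0 (rev_ord j) = 1].
  have [g Ug gz] := sympl_move wi0 zi0 wz.
  have [|h Uh hz] := sympl_move zi0 (er0 j hj); first by rewrite mul_flip_delta.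
  by exists (g * h); [apply: U_fix_mul|rewrite mulmxA gz].
have hrj : hb (rev_ord j) by rewrite hb_rev.
have [wj0|/neq0_1 wj] := eqVneq (w 0 j) 0; last first.
  exists (er (rev_ord j)); split; first exact: er0.
    by rewrite mul_flip_delta rev_ordK.
  by rewrite !mxE !eqxx.
have /rV0Pn[k wk] := w0.
have hk : hb k by apply: contra_neq wk => ->.
have kj : k != j by apply: contraNneq wk => ->; rewrite wj0.
have hrk : hb (rev_ord k) by rewrite hb_rev.
exists (er (rev_ord j) + er (rev_ord k)); split.
- by rewrite mxE !er0 // addr0.
- have -> : flip (er (rev_ord j) + er (rev_ord k)) =
      flip (er (rev_ord j)) + flip (er (rev_ord k)).
    by apply/colP => i; rewrite !mxE.
  by rewrite mulmxDr mxE !mul_flip_delta !rev_ordK wj0 add0r (neq0_1 wk).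
- by rewrite !mxE !eqxx /= (inj_eq rev_ord_inj) eq_sym (negPf kj) addr0.
Qed.

(** Over F_2 invertibility leaves only a = 1 and w_0 = 0. *)
Lemma scn_eq1 C : D C -> scn C NT = 1%:Z%:E.
Proof.
move/class_of_levelP=> [a [w [w0 Us CE]]]; apply/eqP.
rewrite eq_le cn_gt0 andbT; apply: cn_le => //; rewrite pow_set1.
move=> _ /nontrivial_TP[j [x [hj x0 ->]]]; left.
have ur := U_unit Us; have aw0 := scal_row_unit_neq0 ur.
have a1 : a = 1.
  apply: neq0_1; apply: contraTneq ur => ->.
  apply/negP => ur; have : er j *m scal_row 0 w = 0.
    rewrite mulmxDr mul_mx_scalar scale0r add0r mulmxA mul_row_col.
    by rewrite mul_scalar_mx [er j 0 i0]mxE [i0 == j]eq_sym (negPf hj) scale0r.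
  move/(congr1 (mulmx^~ (scal_row 0 w)^-1)); rewrite mulmxK // mul0mx.
  by move/rowP/(_ j)/eqP; rewrite !mxE !eqxx oner_eq0.
have wi0 : w 0 i0 = 0.
  case: (K2 (w 0 i0)) => // wi1.
  by move: aw0; rewrite wi1 a1 add_self eqxx.
have [g Ug <-] := sympl_transitive w0 wi0 hj.
by rewrite CE a1 (neq0_1 x0) scale1r; apply: conj_scal_row_fix.
Qed.

End FullParameter.
End F2.
End Unitary.

(** * The covering number *)

Lemma F2_elements (K : fieldType) (f : {rmorphism 'F_2 -> K}) :
  bijective f -> forall x : K, x = 0 \/ x = 1.
Proof.
move=> [g _ fK] x; rewrite -[x]fK.
by case: (g x) => -[|[|m]] // lt2;
  [left; rewrite -(rmorph0 f)|right; rewrite -(rmorph1 f)];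
  congr (f _); apply: val_inj.
Qed.

Lemma rmorph_F2 (K : fieldType) : (forall x : K, x = 0 \/ x = 1) ->
  exists f : {rmorphism 'F_2 -> K}, bijective f.
Proof.
move=> K2; have two0 : 1 + 1 = 0 :> K := add_self K2 1.
pose f (x : 'F_2) : K := (val x)%:R.
have f_zmod : zmod_morphism f.
  by case=> -[|[|a]] // la [[|[|b]] // lb];
    rewrite /f /= ?subr0 ?sub0r ?subrr //; apply/eqP;
    rewrite -subr_eq0 opprK two0.
have f_mon : monoid_morphism f.
  split=> //; case=> -[|[|a]] // la [[|[|b]] // lb];
  by rewrite /f /= ?mul0r ?mulr0 ?mulr1.
pose fZ := GRing.isZmodMorphism.Build _ _ f f_zmod.
pose fM := GRing.isMonoidMorphism.Build _ _ f f_mon.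
pose fR : {rmorphism 'F_2 -> K} := HB.pack f fZ fM.
exists fR; exists (fun x : K => if x == 0 then 0 else 1).
  case=> -[|[|a]] // la; rewrite /fR /f /=; apply: val_inj => /=.
    by rewrite eqxx.
  by rewrite oner_eq0.
by move=> x; case: (K2 x) => ->; rewrite ?eqxx ?oner_eq0.
Qed.

Theorem theorem39 (K : fieldType) (F : hermitian_form_field K) (n : nat)
    (hmu : mu F = 0)
    (hDelta : [set: K] `*` [set 0] `<=` Delta F)
    (hn : (3 <= n)%N) :
  let Kx0 : set (K * K) := [set: K] `*` [set 0] in
  let D := classes_of_level F n [set 0] Kx0 in
  let T := nontrivial_extra_short F n Kx0 in
  let K_is_F2 := exists f : {rmorphism 'F_2 -> K}, bijective f in
  (K_is_F2 /\ Delta F (0, 1) -> scn_family D T = 1%:E) /\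
  (~ (K_is_F2 /\ Delta F (0, 1)) -> scn_family D T = 2%:E).
Proof.
move=> Kx0 D T K_is_F2; split=> [[[f /F2_elements K2] D01]|nF2].
  have [k hk _] := exists_hb_neq hn (idx0 n).
  pose w : 'rV[K]_n.*2.+1 := delta_mx 0 k.
  have w0 : w != 0 by apply/eqP => /rowP/(_ k)/eqP; rewrite !mxE !eqxx oner_eq0.
  have wi0 : 1 + w 0 (idx0 n) != 0.
    by rewrite mxE [idx0 n == k]eq_sym (negPf hk) addr0 oner_eq0.
  have eq1 C : D C -> scn C T = 1%:E by apply: scn_eq1.
  have DC := class_of_level_scal_row hmu hDelta hn w0 wi0.
  apply: supremum_max => [|_ [C /eq1 -> <-]] //.
  by eexists; [exact: DC|exact: eq1].
suff [C DC geC] : exists2 C, D C & (2%:E <= scn C T)%E.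
  apply: supremum_max => [|_ [B DB <-]]; last exact: scn_le2.
  by exists C => //; apply/eqP; rewrite eq_le geC andbT; apply: scn_le2.
have [K2|] := pselect (forall x : K, x = 0 \/ x = 1).
  apply: class_nonsingular => // D01; apply: nF2; split=> //.
  exact: rmorph_F2.
move/existsNP=> [c /not_orP[/eqP c0 /eqP c1]].
exact: (class_scalar hmu hDelta hn c0 c1).
Qed.
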